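(* Let $p$ be a prime, $m,d\ge1$ integers, $0<\rho\le p^{-d}-p^{-d-m}$, $y\in X_{m,d}$, and let $u:X_{m,d}\to\mathbb{R}$ solve $$D_du(x)+\rho e^{u(x)}=\rho p^d\,\boldsymbol{1}_{\{x=y\}}\quad\text{for all }x\in X_{m,d}.$$ Then for $x,x'\in X_{m,d}$ with $v_p(x)=v_p(x')=v_p(y)$ and $d(x,y)<d(x',y)$ we have $u(x)<u(x')$. Equivalently, writing $y=p^l(c_0+c_1p+\dots+c_{d-1}p^{d-1})$ and $u_l(c_0,\dots,c_s)$ for the (common) value of $u$ at the points of $p^l\mathbb{Z}_p^\times$-shell with $d(x,y)=p^{-(s+1)}$, $u_l(c_0,\dots,c_{d-1})=u(y)$, and $u_l$ for the value at points of the shell with $d(x,y)=1$: $$u_l(c_0,\dots,c_{d-1})<u_l(c_0,\dots,c_{d-2})<\dots<u_l(c_0)<u_l.$$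
   Context: $X_{m,d}$ is the finite set of rational numbers $x=p^l(b_0+b_1p+\dots+b_{d-1}p^{d-1})$ with $l\in\{0,\dots,m-1\}$, $b_0\in\{1,\dots,p-1\}$, $b_i\in\{0,\dots,p-1\}$ for $1\le i\le d-1$. $|\cdot|_p$ is the $p$-adic absolute value, $v_p$ the $p$-adic valuation. $d(x,y)=\frac{|x-y|_p}{\max\{|x|_p,|y|_p\}}$. $D_du(x)=p^{-d}\sum_{z\in X_{m,d},\,z\ne x}\frac{|z|_p|x|_p}{|z-x|_p^2}(u(z)-u(x))$. (Under the hypothesis on $\rho$, $u$ restricted to the shell $v_p(x)=v_p(y)$ depends only on $d(x,y)$, so the values $u_l(c_0,\dots,c_s)$ are well defined.) *)

(* Defs.v *)
From HB Require Import structures.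
From mathcomp Require Import all_boot all_order all_algebra finmap.
From mathcomp Require Import all_classical all_reals all_analysis.

Set Implicit Arguments.
Unset Strict Implicit.
Unset Printing Implicit Defensive.

Import Order.TTheory GRing.Theory Num.Theory.

Local Open Scope fset_scope.
Local Open Scope ring_scope.

(* Junk value 0 at [x = 0], in place of +oo; [Xset] below does not contain 0. *)
Definition padic_val (p : nat) (x : rat) : int :=
  (logn p `|numq x|%N)%:Z - (logn p `|denq x|%N)%:Z.

Definition padic_abs (R : realType) (p : nat) (x : rat) : R :=
  if x == 0 then 0 else p%:R ^ (- padic_val p x).

Definition padic_rdist (R : realType) (p : nat) (x y : rat) : R :=
  padic_abs R p (x - y) / Num.max (padic_abs R p x) (padic_abs R p y).

(* Digit strings [b_0, ..., b_(d-1)] in base [p] with [b_0 != 0]. *)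
Definition digits (p d : nat) : pred {ffun 'I_d -> 'I_p} :=
  fun b => [forall i : 'I_d, (i == 0%N :> nat) ==> (b i != 0%N :> nat)].

Definition padic_point (p m d : nat) (l : 'I_m) (b : {ffun 'I_d -> 'I_p}) :
    rat :=
  p%:R ^+ l * \sum_(i < d) (b i)%:R * p%:R ^+ i.

Definition Xset (p m d : nat) : {fset rat} :=
  [fset padic_point l b | l in 'I_m, b in @digits p d].

Definition Dop (R : realType) (p m d : nat) (u : Xset p m d -> R)
    (x : Xset p m d) : R :=
  p%:R ^- d *
  \sum_(z : Xset p m d | z != x)
    padic_abs R p (val z) * padic_abs R p (val x)
      / padic_abs R p (val z - val x) ^+ 2 * (u z - u x).

(* If [y = p^l (c_0 + ... + c_(d-1) p^(d-1))] and [k < d], these are the points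
   of the shell of [y] sharing with [y] exactly the digits [c_i], [i < k]. *)
Definition shell_sphere (R : realType) (p m d : nat) (y : Xset p m d)
    (k : nat) : {set Xset p m d} :=
  [set x | (padic_val p (val x) == padic_val p (val y)) &&
           (padic_rdist R p (val x) (val y) == p%:R ^- k)]%SET.

Definition common_value (R : realType) (T : finType) (u : T -> R)
    (A : {set T}) (w : R) : Prop :=
  (exists x, x \in A) /\ (forall x, x \in A -> u x = w).

(* Main.v *)
Require Import Defs.
From mathcomp Require Import all_boot all_order all_algebra finmap.
From mathcomp Require Import all_classical all_reals all_analysis.
From mathcomp Require Import ring lra zify.

(** Differences within [X] are compared through the ultrametric inequality, and
    symmetry of the kernel gives [\sum_x D u x = 0], hence
    [\sum_x e^(u x) = p^d].  Every row of the kernel dominates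
    [min(|x|,|z|) / max(|x|,|z|)], whose sum over [z], times [p^-d], is at
    least [1 - p^-m >= rho p^d > rho e^(u x)].  Now take [x] maximal for [u]
    over the points of the shell of [y] closer to [y] than [r], and [x']
    minimal over those at distance [r].  If [u x' <= u x], then comparing
    the two flows point by point yields
    [D u x - D u x' <= - (1 - p^-m) (u x - u x')], whereas the equation gives
    [D u x - D u x' >= - rho (e^(u x) - e^(u x')) >= - rho e^(u x) (u x - u x')];
    the slack at [z = y] makes this contradictory.  The same comparison
    between a maximum and a minimum over one sphere shows that [u] is constant
    there. *)

Set Implicit Arguments.
Unset Strict Implicit.
Unset Printing Implicit Defensive.

Import Order.TTheory GRing.Theory Num.Theory.

Local Open Scope ring_scope.

(** * Valuation and absolute value on the rationals *)

Lemma padic_val_frac (p : nat) (a b : int) : a != 0 -> b != 0 ->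
  padic_val p (a%:~R / b%:~R) = (logn p `|a|%N)%:Z - (logn p `|b|%N)%:Z.
Proof.
move=> a0 b0; set x : rat := _ / _.
have b0' : b%:~R != 0 :> rat by rewrite intr_eq0.
have x0 : x != 0 by rewrite mulf_neq0 ?invr_eq0 ?intr_eq0.
(* Cross-multiplying handles fractions not in lowest terms: valuations are compared on an identity
   between integers. *)
have E : numq x * b = a * denq x.
  apply: (@intr_inj rat); rewrite !rmorphM /= numqE /x.
  by rewrite mulrAC divfK.
have := congr1 (fun t : int => logn p `|t|%N) E.
rewrite /= !abszM !lognM ?absz_gt0 ?numq_eq0 ?denq_neq0 //.
rewrite /padic_val; lia.
Qed.

Lemma padic_val_nat (p n : nat) : padic_val p n%:R = (logn p n)%:Z.
Proof. by rewrite /padic_val pmulrn numq_int denq_int logn1 subr0. Qed.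

Lemma logn_absz_sub (p : nat) (a b : int) : prime p -> a - b != 0 ->
  a != 0 -> b != 0 ->
  (minn (logn p `|a|) (logn p `|b|) <= logn p `|(a - b)%R|)%N.
Proof.
move=> pp ab0 a0 b0; rewrite -pfactor_dvdn ?absz_gt0 //.
set k := minn _ _.
have da : (p ^ k %| `|a|)%N by rewrite pfactor_dvdn ?absz_gt0 // geq_minl.
have db : (p ^ k %| `|b|)%N by rewrite pfactor_dvdn ?absz_gt0 // geq_minr.
by have : ((p ^ k)%N %| a - b)%Z by apply: rpredB; rewrite dvdzE.
Qed.

(** Over the common denominator [c], the claim reduces to divisibility of a difference of
    integers. *)
Lemma padic_val_sub (p : nat) (x y : rat) : prime p ->
  x != 0 -> y != 0 -> x - y != 0 ->
  Num.min (padic_val p x) (padic_val p y) <= padic_val p (x - y).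
Proof.
move=> pp x0 y0 xy0.
have nx : (denq x)%:~R != 0 :> rat by rewrite intr_eq0 denq_neq0.
have ny : (denq y)%:~R != 0 :> rat by rewrite intr_eq0 denq_neq0.
set c := denq x * denq y; set a := numq x * denq y; set b := numq y * denq x.
have c0 : c != 0 by rewrite mulf_neq0 ?denq_neq0.
have a0 : a != 0 by rewrite mulf_neq0 ?denq_neq0 ?numq_eq0.
have b0 : b != 0 by rewrite mulf_neq0 ?denq_neq0 ?numq_eq0.
have Ex : x = a%:~R / c%:~R.
  by rewrite /a /c !rmorphM /= numqE; field; rewrite nx ny.
have Ey : y = b%:~R / c%:~R.
  by rewrite /b /c !rmorphM /= numqE; field; rewrite nx ny.
have Exy : x - y = (a - b)%:~R / c%:~R by rewrite rmorphB mulrBl -Ex -Ey.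
have ab0 : a - b != 0.
  by apply: contraNneq xy0 => ab; rewrite Exy ab mul0r.
rewrite Exy Ex Ey !padic_val_frac //.
by rewrite ge_min !lerD2r !lez_nat -geq_min logn_absz_sub.
Qed.

Lemma padic_abs0 (R : realType) (p : nat) : padic_abs R p 0 = 0.
Proof. by rewrite /padic_abs eqxx. Qed.

Lemma padic_absN (R : realType) (p : nat) (x : rat) :
  padic_abs R p (- x) = padic_abs R p x.
Proof. by rewrite /padic_abs /padic_val oppr_eq0 numqN denqN abszN. Qed.

Lemma padic_abs_subC (R : realType) (p : nat) (x y : rat) :
  padic_abs R p (x - y) = padic_abs R p (y - x).
Proof. by rewrite -opprB padic_absN. Qed.

Lemma padic_abs_gt0 (R : realType) (p : nat) (x : rat) : prime p ->
  x != 0 -> 0 < padic_abs R p x.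
Proof.
move=> /prime_gt0 p0 x0; rewrite /padic_abs (negPf x0).
by rewrite exprz_gt0 // ltr0n.
Qed.

Lemma padic_abs_ge0 (R : realType) (p : nat) (x : rat) : 0 <= padic_abs R p x.
Proof.
by rewrite /padic_abs; case: ifP => // _; rewrite exprz_ge0.
Qed.

Lemma padic_abs_sub_le (R : realType) (p : nat) (x y : rat) : prime p ->
  padic_abs R p (x - y) <= Num.max (padic_abs R p x) (padic_abs R p y).
Proof.
move=> pp; have p1 : 1 <= p%:R :> R by rewrite ler1n prime_gt0.
have [->|x0] := eqVneq x 0.
  by rewrite sub0r padic_absN le_max lexx orbT.
have [->|y0] := eqVneq y 0; first by rewrite subr0 le_max lexx.
have [->|xy0] := eqVneq (x - y) 0.
  by rewrite padic_abs0 le_max padic_abs_ge0.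
rewrite /padic_abs (negPf x0) (negPf y0) (negPf xy0) le_max.
have := padic_val_sub pp x0 y0 xy0; rewrite ge_min => /orP[h|h].
  by rewrite ler_weXz2l // lerN2.
by rewrite orbC ler_weXz2l // lerN2.
Qed.

(** Isosceles principle: [y = x - (x - y)] bounds [|y|] by the maximum of [|x|] and [|x - y|], and
    [|x|] is too small to attain it. *)
Lemma padic_abs_sub_lt (R : realType) (p : nat) (x y : rat) : prime p ->
  padic_abs R p x < padic_abs R p y ->
  padic_abs R p (x - y) = padic_abs R p y.
Proof.
move=> pp xy; apply/eqP; rewrite eq_le.
have := padic_abs_sub_le R x y pp; rewrite (max_r (ltW xy)) => -> /=.
have := padic_abs_sub_le R x (x - y) pp.
by rewrite subKr le_max leNgt xy.
Qed.

(** Seen from a point [z] farther from [y] than [x] is, the centre [y] may be replaced by [x]. *)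
Lemma padic_abs_center (R : realType) (p : nat) (x y z : rat) : prime p ->
  padic_abs R p (x - y) < padic_abs R p (z - y) ->
  padic_abs R p (z - x) = padic_abs R p (z - y).
Proof.
move=> pp /(padic_abs_sub_lt pp) <-; rewrite padic_abs_subC.
by congr padic_abs; ring.
Qed.

Lemma padic_abs_eq_val (R : realType) (p : nat) (x y : rat) : prime p ->
  x != 0 -> y != 0 ->
  (padic_val p x == padic_val p y) = (padic_abs R p x == padic_abs R p y).
Proof.
move=> pp x0 y0; rewrite /padic_abs (negPf x0) (negPf y0).
rewrite -(inj_eq (@oppr_inj int)); apply/eqP/eqP => [-> //|].
have p1 : 1 < p%:R :> R by rewrite ltr1n prime_gt1.
apply: ieexprIz; first by rewrite (lt_trans _ p1).
by rewrite gt_eqF.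
Qed.

Lemma padic_rdist_shell (R : realType) (p : nat) (x y : rat) : prime p ->
  x != 0 -> y != 0 -> padic_val p x = padic_val p y ->
  padic_rdist R p x y = padic_abs R p (x - y) / padic_abs R p y.
Proof.
move=> pp x0 y0 /eqP; rewrite (padic_abs_eq_val R pp) // => /eqP e.
by rewrite /padic_rdist e maxxx.
Qed.

(** * Digit expansions and the points of [Xset] *)

Definition digit_sum (p d : nat) (b : {ffun 'I_d -> 'I_p}) : nat :=
  (\sum_(i < d) b i * p ^ i)%N.

Lemma padic_pointE (p m d : nat) (l : 'I_m) (b : {ffun 'I_d -> 'I_p}) :
  padic_point l b = (p ^ l * digit_sum b)%:R.
Proof.
rewrite /padic_point natrM natrX natr_sum; congr (_ * _).
by apply: eq_bigr => i _; rewrite natrM natrX.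
Qed.

Lemma digit_sum_recl (p d : nat) (b : {ffun 'I_d.+1 -> 'I_p}) :
  digit_sum b = (b ord0 + p * digit_sum [ffun i => b (lift ord0 i)])%N.
Proof.
rewrite /digit_sum big_ord_recl expn0 muln1 big_distrr; congr addn.
by apply: eq_bigr => i _; rewrite ffunE expnS mulnCA.
Qed.

Lemma digit_sum_mod (p d : nat) (b : {ffun 'I_d.+1 -> 'I_p}) :
  (digit_sum b %% p)%N = b ord0.
Proof. by rewrite digit_sum_recl mulnC addnC modnMDl modn_small. Qed.

(** The residue mod [p] recovers the leading digit; removing it leaves a shorter expansion. *)
Lemma digit_sum_inj (p d : nat) : injective (@digit_sum p d).
Proof.
elim: d => [|d IH] b b' e; first by apply/ffunP => -[].
have e0 : b ord0 = b' ord0.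
  by apply: ord_inj; rewrite -!digit_sum_mod e.
have p0 : (0 < p)%N by apply: leq_ltn_trans (ltn_ord (b ord0)).
move: e; rewrite !digit_sum_recl e0 => /addnI /eqP.
rewrite eqn_pmul2l // => /eqP /IH /ffunP e.
apply/ffunP => i; case: (unliftP ord0 i) => [j ->|-> //].
by have := e j; rewrite !ffunE.
Qed.

Lemma digit_sum_ndvd (p d : nat) (b : {ffun 'I_d -> 'I_p}) :
  (0 < d)%N -> b \in @digits p d -> ~~ (p %| digit_sum b)%N.
Proof.
case: d b => // d b _ /forallP /(_ ord0) /= b0.
by rewrite /dvdn digit_sum_mod.
Qed.

Lemma padic_val_pnat (p n k : nat) : prime p -> ~~ (p %| n)%N ->
  padic_val p (p ^ k * n)%:R = k%:Z.
Proof.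
move=> pp pn; have n0 : (0 < n)%N.
  by rewrite lt0n; apply: contraNneq pn => ->; exact: dvdn0.
have pk0 : (0 < p ^ k)%N by rewrite expn_gt0 prime_gt0.
by rewrite padic_val_nat lognM // pfactorK // logn_coprime ?prime_coprime ?addn0.
Qed.

Lemma padic_val_point (p m d : nat) (l : 'I_m) (b : {ffun 'I_d -> 'I_p}) :
  prime p -> (0 < d)%N -> b \in @digits p d ->
  padic_val p (padic_point l b) = l%:Z.
Proof. by move=> pp d0 bd; rewrite padic_pointE padic_val_pnat ?digit_sum_ndvd. Qed.

Lemma padic_point_neq0 (p m d : nat) (l : 'I_m) (b : {ffun 'I_d -> 'I_p}) :
  prime p -> (0 < d)%N -> b \in @digits p d -> padic_point l b != 0.
Proof.
move=> pp d0 bd; rewrite padic_pointE pnatr_eq0 muln_eq0 expn_eq0.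
rewrite eqn0Ngt prime_gt0 //=; apply: contraNneq (digit_sum_ndvd d0 bd) => ->.
exact: dvdn0.
Qed.

Lemma padic_point_inj (p m d : nat) (l l' : 'I_m)
    (b b' : {ffun 'I_d -> 'I_p}) : prime p -> (0 < d)%N ->
  b \in @digits p d -> b' \in @digits p d ->
  padic_point l b = padic_point l' b' -> (l, b) = (l', b').
Proof.
move=> pp d0 bd b'd e; have := padic_val_point l pp d0 bd.
rewrite e padic_val_point // => -[/ord_inj el]; rewrite -{}el in e *.
move/eqP: e; rewrite !padic_pointE eqr_nat eqn_pmul2l ?expn_gt0 ?prime_gt0 //.
by move=> /eqP /digit_sum_inj ->.
Qed.

Lemma XsetP (p m d : nat) (x : Xset p m d) :
  exists l : 'I_m, exists2 b, b \in @digits p d & val x = padic_point l b.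
Proof.
by have /imfset2P[l _ [b bd ->]] := valP x; exists l, b.
Qed.

Lemma padic_point_Xset (p m d : nat) (l : 'I_m) (b : {ffun 'I_d -> 'I_p}) :
  b \in @digits p d -> padic_point l b \in Xset p m d.
Proof. by move=> bd; apply/imfset2P; exists l => //; exists b. Qed.

Lemma Xset_neq0 (p m d : nat) (x : Xset p m d) : prime p -> (0 < d)%N ->
  val x != 0.
Proof. by move=> pp d0; have [l [b bd ->]] := XsetP x; apply: padic_point_neq0. Qed.

Lemma card_digits (p d : nat) : (0 < d)%N ->
  #|@digits p d| = (p.-1 * p ^ d.-1)%N.
Proof.
case: d => // d _.
pose F (i : 'I_d.+1) : pred 'I_p :=
  fun j => (i == 0%N :> nat) ==> (j != 0%N :> nat).
have -> : #|@digits p d.+1| = #|family F|.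
  apply: eq_card => b; apply/forallP/familyP => h i; exact: h.
rewrite card_family foldrE big_map big_enum /= big_ord_recl; congr muln.
  rewrite /F; case: p {F} => [|p]; first by apply: eq_card0 => -[].
  transitivity #|predC1 (ord0 : 'I_p.+1)|; last by rewrite cardC1 card_ord.
  by apply: eq_card => j; rewrite [RHS]inE -val_eqE.
rewrite (eq_bigr (fun=> p)) ?prod_nat_const ?card_ord // => i _.
by rewrite -[RHS]card_ord; apply: eq_card.
Qed.

(** * Lower bound for the row sums of the kernel *)

(** Truncated subtraction makes the exponent [|l - j|]. In the induction, the case [l = m] is the
    geometric sum reversed; otherwise the new last term has exponent [m - l <= m]. *)
Lemma sum_dist_exp_ge (R : realType) (q : R) (l m : nat) : 0 <= q <= 1 ->
  (l < m)%N -> \sum_(j < m) q ^+ j <= \sum_(j < m) q ^+ ((l - j) + (j - l))%N.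
Proof.
move=> /andP[q0 q1]; elim: m => // m IH; rewrite ltnS leq_eqVlt => /orP[/eqP->|lm].
  rewrite [leLHS](reindex_inj rev_ord_inj) /=.
  by apply: ler_sum => j _; rewrite ler_wiXn2l //; have := ltn_ord j; lia.
rewrite !big_ord_recr /= lerD ?IH // ler_wiXn2l //; lia.
Qed.

(** This is [min(|x|,|z|) / max(|x|,|z|)]: the kernel with [|z - x|] replaced by its ultrametric
    upper bound. It depends only on the two shells and, for [x != 0], equals 1 at [z = x]. *)
Definition shell_weight (R : realType) (p : nat) (x z : rat) : R :=
  padic_abs R p z * padic_abs R p x
    / Num.max (padic_abs R p x) (padic_abs R p z) ^+ 2.

Lemma padic_abs_point (R : realType) (p m d : nat) (l : 'I_m)
    (b : {ffun 'I_d -> 'I_p}) : prime p -> (0 < d)%N -> b \in @digits p d ->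
  padic_abs R p (padic_point l b) = p%:R^-1 ^+ l.
Proof.
move=> pp d0 bd; rewrite /padic_abs (negPf (padic_point_neq0 _ pp d0 bd)).
by rewrite padic_val_point // -exprnN exprVn.
Qed.

Lemma shell_weight_point (R : realType) (p m d : nat) (l l' : 'I_m)
    (b b' : {ffun 'I_d -> 'I_p}) : prime p -> (0 < d)%N ->
  b \in @digits p d -> b' \in @digits p d ->
  shell_weight R p (padic_point l b) (padic_point l' b') =
  p%:R^-1 ^+ ((l - l') + (l' - l))%N.
Proof.
move=> pp d0 bd b'd; rewrite /shell_weight !padic_abs_point //.
set q : R := p%:R^-1.
have q0 : 0 < q by rewrite invr_gt0 ltr0n prime_gt0.
have q1 : q <= 1 by rewrite invf_le1 ?ltr0n ?prime_gt0 // ler1n prime_gt0.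
have aux (i j : nat) : (i <= j)%N -> q ^+ i * q ^+ j / (q ^+ i) ^+ 2 = q ^+ (j - i).
  move=> ij; rewrite -{1}(subnK ij) exprD; field; rewrite expf_neq0 ?gt_eqF //.
have [ij|/ltnW ij] := leqP l l'.
  by rewrite max_l ?ler_wiXn2l ?(ltW q0) // [X in X / _]mulrC aux //;
    congr (_ ^+ _); lia.
by rewrite max_r ?ler_wiXn2l ?(ltW q0) // aux //; congr (_ ^+ _); lia.
Qed.

Lemma shell_weight_ge0 (R : realType) (p : nat) (x z : rat) :
  0 <= shell_weight R p x z.
Proof.
by apply: divr_ge0; [apply: mulr_ge0; apply: padic_abs_ge0|apply: sqr_ge0].
Qed.

(** Each shell [j] has [(p - 1) p^(d-1)] points of weight [q^|l - j|] with [q = 1/p]. After division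
    by [p^d] the count becomes [1 - q], and the geometric sum gives [1 - q^m]. *)
Lemma shell_weight_sum_ge (R : realType) (p m d : nat) (x : Xset p m d) :
  prime p -> (0 < d)%N ->
  1 - p%:R ^- m <=
    p%:R ^- d * \sum_(z : Xset p m d) shell_weight R p (val x) (val z).
Proof.
move=> pp d0; have [l [b bd xE]] := XsetP x.
(* The default [x] of [insubd] is never reached on [A], where the digit strings are admissible. *)
pose h (a : 'I_m * {ffun 'I_d -> 'I_p}) := insubd x (padic_point a.1 a.2).
pose A := [set a : 'I_m * {ffun 'I_d -> 'I_p} | a.2 \in @digits p d].
have hE a : a \in A -> val (h a) = padic_point a.1 a.2.
  by rewrite inE => ad; rewrite insubdK // padic_point_Xset.
have hinj : {in A &, injective h}.
  move=> [i a] [j c] iA jA /(congr1 val); rewrite !hE //=.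
  by apply: padic_point_inj => //; move: iA jA; rewrite !inE.
set q : R := p%:R^-1.
have q01 : 0 <= q <= 1.
  by rewrite invr_ge0 ler0n invf_le1 ?ltr0n ?prime_gt0 // ler1n prime_gt0.
have -> : 1 - p%:R ^- m = (1 - q) * \sum_(j < m) q ^+ j.
  by rewrite -exprVn -/q -opprB subrX1 -mulNr opprB.
apply: (@le_trans _ _ ((1 - q) * \sum_(j < m) q ^+ ((l - j) + (j - l))%N)).
  by rewrite ler_wpM2l ?sum_dist_exp_ge // subr_ge0; case/andP: q01.
have -> : (1 - q) * \sum_(j < m) q ^+ ((l - j) + (j - l))%N =
    p%:R ^- d * \sum_(z in h @: A) shell_weight R p (val x) (val z).
  rewrite big_imset //=.
  rewrite (eq_bigr (fun a : 'I_m * _ => q ^+ ((l - a.1) + (a.1 - l))%N)); last first.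
    move=> a aA; rewrite hE // xE shell_weight_point //.
    by move: aA; rewrite inE.
  rewrite (eq_bigl (fun a => xpredT a.1 && (a.2 \in @digits p d))); last first.
    by move=> a; rewrite inE.
  rewrite -(pair_big xpredT (fun c => c \in @digits p d)
    (fun (j : 'I_m) _ => q ^+ ((l - j) + (j - l))%N)) /=.
  rewrite !mulr_sumr; apply: eq_bigr => j _; rewrite sumr_const card_digits //.
  rewrite mulrnAr -mulrnAl -[X in _ = X * _]mulr_natl; congr (_ * _).
  case: d d0 {b bd xE h A hE hinj x} => // d _; rewrite /= natrM natrX exprS.
  have p0 : p%:R != 0 :> R by rewrite pnatr_eq0 -lt0n prime_gt0.
  rewrite -subn1 natrB ?prime_gt0 // /q; field.
  by rewrite p0 expf_neq0.
(* Restricting the sum to the image of [A] can only lower it, the weights being nonnegative. *)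
rewrite ler_wpM2l ?invr_ge0 ?exprn_ge0 //.
rewrite [leRHS](bigID (mem (h @: A))) /= lerDl sumr_ge0 // => z _.
exact: shell_weight_ge0.
Qed.

(** * The kernel, the operator and the total mass of [expR (u x)] *)

(** At [z = x] division by zero gives the value 0; in [DopE] the factor [u z - u x] kills the
    diagonal term in any case. *)
Definition kernel (R : realType) (p : nat) (x z : rat) : R :=
  padic_abs R p z * padic_abs R p x / padic_abs R p (z - x) ^+ 2.

Lemma kernelC (R : realType) (p : nat) (x z : rat) :
  kernel R p x z = kernel R p z x.
Proof.
by rewrite /kernel padic_abs_subC [padic_abs R p z * _]mulrC.
Qed.

Lemma shell_weight_le_kernel (R : realType) (p : nat) (x z : rat) : prime p ->
  z != x -> shell_weight R p x z <= kernel R p x z.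
Proof.
move=> pp zx; have zx0 : 0 < padic_abs R p (z - x).
  by rewrite padic_abs_gt0 // subr_eq0.
have le := padic_abs_sub_le R z x pp; rewrite maxC in le.
rewrite ler_wpM2l ?mulr_ge0 ?padic_abs_ge0 // lef_pV2 ?posrE ?exprn_gt0 //.
  by rewrite ler_pXn2r ?nnegrE ?(ltW zx0) // (le_trans _ le) // ltW.
exact: lt_le_trans le.
Qed.

Lemma kernel_eq (R : realType) (p : nat) (x x' z : rat) :
  padic_abs R p x = padic_abs R p x' ->
  padic_abs R p (z - x) = padic_abs R p (z - x') ->
  kernel R p x z = kernel R p x' z.
Proof. by rewrite /kernel => -> ->. Qed.

Lemma kernel_le (R : realType) (p : nat) (x x' z : rat) : prime p ->
  z != x -> padic_abs R p x = padic_abs R p x' ->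
  padic_abs R p (z - x) <= padic_abs R p (z - x') ->
  kernel R p x' z <= kernel R p x z.
Proof.
move=> pp zx e le; have zx0 : 0 < padic_abs R p (z - x).
  by rewrite padic_abs_gt0 // subr_eq0.
rewrite /kernel e ler_wpM2l ?mulr_ge0 ?padic_abs_ge0 //.
rewrite lef_pV2 ?posrE ?exprn_gt0 ?(lt_le_trans zx0 le) //.
by rewrite ler_pXn2r ?nnegrE ?padic_abs_ge0.
Qed.

Lemma kernel_lt (R : realType) (p : nat) (x x' z : rat) : prime p ->
  z != 0 -> x' != 0 -> z != x -> padic_abs R p x = padic_abs R p x' ->
  padic_abs R p (z - x) < padic_abs R p (z - x') ->
  kernel R p x' z < kernel R p x z.
Proof.
move=> pp z0 x'0 zx e le; have zx0 : 0 < padic_abs R p (z - x).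
  by rewrite padic_abs_gt0 // subr_eq0.
rewrite /kernel e ltr_pM2l ?mulr_gt0 ?padic_abs_gt0 //.
rewrite ltf_pV2 ?posrE ?exprn_gt0 ?(lt_trans zx0 le) //.
by rewrite ltr_pXn2r ?nnegrE ?padic_abs_ge0.
Qed.

Lemma padic_abs_off_shell (R : realType) (p : nat) (x z : rat) : prime p ->
  padic_abs R p z != padic_abs R p x ->
  padic_abs R p (z - x) = Num.max (padic_abs R p z) (padic_abs R p x).
Proof.
move=> pp; rewrite neq_lt => /orP[h|h].
  by rewrite padic_abs_sub_lt // max_r // ltW.
by rewrite padic_abs_subC padic_abs_sub_lt // max_l // ltW.
Qed.

Lemma DopE (R : realType) (p m d : nat) (u : Xset p m d -> R) (x : Xset p m d) :
  Dop u x = p%:R ^- d *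
    \sum_(z : Xset p m d) kernel R p (val x) (val z) * (u z - u x).
Proof.
rewrite /Dop; congr (_ * _).
by rewrite [RHS](bigD1 x) //= subrr mulr0 add0r.
Qed.

(** Exchanging the two summation variables changes the sign of each term, since the kernel is
    symmetric. *)
Lemma sum_Dop (R : realType) (p m d : nat) (u : Xset p m d -> R) :
  \sum_(x : Xset p m d) Dop u x = 0.
Proof.
under eq_bigr do rewrite DopE.
rewrite -mulr_sumr; set S := (X in _ * X).
suff SN : S = - S 
  by apply/eqP; rewrite mulf_eq0; apply/orP; right; apply/eqP; lra.
rewrite {1}/S exchange_big /= /S -sumrN; apply: eq_bigr => x _.
rewrite -sumrN; apply: eq_bigr => z _.
by rewrite kernelC; ring.
Qed.

Lemma sum_expR (R : realType) (p m d : nat) (rho c : R) (y : Xset p m d)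
    (u : Xset p m d -> R) : rho != 0 ->
  (forall x, Dop u x + rho * expR (u x) = rho * c * (x == y)%:R) ->
  \sum_(x : Xset p m d) expR (u x) = c.
Proof.
move=> rho0 hu; apply: (mulfI rho0).
have : \sum_x (Dop u x + rho * expR (u x)) = rho * c.
  rewrite (eq_bigr _ (fun x _ => hu x)) (bigD1 y) //= eqxx mulr1 big1 ?addr0 //.
  by move=> x /negPf ->; rewrite mulr0.
by rewrite big_split /= sum_Dop add0r -mulr_sumr.
Qed.

(** The total mass of [expR (u z)] is [p^d]. Keeping two of its terms makes each of them strictly
    less than [p^d], which later yields the strict bound [rho * expR (u x) < 1 - p^-m]. *)
Lemma expR_pair_le (R : realType) (p m d : nat) (rho : R) (y x x' : Xset p m d)
    (u : Xset p m d -> R) : prime p ->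
  0 < rho -> rho <= p%:R ^- d - p%:R ^- (d + m) ->
  (forall x, Dop u x + rho * expR (u x) = rho * p%:R ^+ d * (x == y)%:R) ->
  x != x' ->
  expR (u x) + expR (u x') <= p%:R ^+ d /\ rho * p%:R ^+ d <= 1 - p%:R ^- m.
Proof.
move=> pp rho0 hrho hu xx'; split.
  rewrite -(sum_expR (lt0r_neq0 rho0) hu) (bigD1 x) //= lerD2l.
  rewrite (bigD1 x') 1?eq_sym //= lerDl sumr_ge0 // => z _; exact: expR_ge0.
have p0 : 0 < p%:R :> R by rewrite ltr0n prime_gt0.
apply: le_trans (ler_wpM2r (exprn_ge0 d (ltW p0)) hrho) _.
rewrite mulrBl mulVf ?expf_neq0 ?gt_eqF // exprD invfM mulrAC mulVf ?mul1r //.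
by rewrite expf_neq0 ?gt_eqF.
Qed.

(** * Comparison of the flows at two points *)

(** Convexity: the exponential lies above its tangent at [s]. *)
Lemma expR_sub_le (R : realType) (s t : R) :
  expR s - expR t <= expR s * (s - t).
Proof.
have -> : expR t = expR s * expR (t - s) by rewrite -expRD addrC subrK.
have := expR_ge1Dx (t - s); have := expR_gt0 s; nra.
Qed.

(* The error terms [e] record the part of the flow that the uniform bound
   wastes; they make the comparison strict. *)
Lemma Dop_comparison (R : realType) (p m d : nat) (u e : Xset p m d -> R)
    (x x' : Xset p m d) : prime p -> (0 < d)%N -> u x' <= u x ->
  (forall z : Xset p m d,
    kernel R p (val x) (val z) * (u z - u x)
      - kernel R p (val x') (val z) * (u z - u x')
    <= shell_weight R p (val x) (val z) * (u x' - u x) + e z) ->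
  Dop u x - Dop u x' <=
    (1 - p%:R ^- m) * (u x' - u x) + p%:R ^- d * \sum_(z : Xset p m d) e z.
Proof.
move=> pp d0 le h; rewrite !DopE -mulrBr -sumrB.
have q0 : 0 <= p%:R ^- d :> R by rewrite invr_ge0 exprn_ge0.
apply: (@le_trans _ _ (p%:R ^- d * \sum_(z : Xset p m d)
    (shell_weight R p (val x) (val z) * (u x' - u x) + e z))).
  by apply: ler_wpM2l => //; apply: ler_sum => z _; exact: h.
rewrite big_split /= mulrDr lerD2r -mulr_suml mulrA.
(* As [u x' - u x <= 0], the lower bound on the row sum becomes an upper bound on the flow. *)
by rewrite ler_wnM2r ?subr_le0 // shell_weight_sum_ge.
Qed.

(** Pointwise form of the comparison, with [A], [B] the two kernel values at [z] and [s], [t], [v]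
    the values of [u] at [x], [x'], [z]. Once both are replaced by a common [c], the value [v]
    cancels and [c * (t - s)] remains. *)
Lemma flow_le (R : realType) (c A B w s t v : R) : t <= s -> w <= c ->
  A * (v - s) <= c * (v - s) -> c * (v - t) <= B * (v - t) ->
  A * (v - s) - B * (v - t) <= w * (t - s).
Proof.
move=> ts wc h1 h2; apply: (@le_trans _ _ (c * (t - s))); first by lra.
by rewrite ler_wnM2r ?subr_le0.
Qed.

Lemma padic_abs_far (R : realType) (p : nat) (x y z : rat) : prime p ->
  padic_abs R p x = padic_abs R p y ->
  (padic_abs R p z != padic_abs R p y) ||
    (padic_abs R p (x - y) < padic_abs R p (z - y)) ->
  padic_abs R p (z - x) = padic_abs R p (z - y) /\ z != x.
Proof.
move=> pp xy /orP[zy|h].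
  rewrite !padic_abs_off_shell ?xy //; split => //.
  by apply: contraNneq zy => ->; rewrite xy.
rewrite (padic_abs_center pp h); split => //.
by apply: contraTneq h => ->; rewrite ltxx.
Qed.

(** Such a [z] is equally distant from [x], [x'] and [y], so the two kernel values coincide and
    serve as [c]. *)
Lemma flow_le_far (R : realType) (p : nat) (x x' y z : rat) (s t v : R) :
  prime p ->
  padic_abs R p x = padic_abs R p y -> padic_abs R p x' = padic_abs R p y ->
  (padic_abs R p z != padic_abs R p y) ||
    (padic_abs R p (x - y) < padic_abs R p (z - y)) ->
  (padic_abs R p z != padic_abs R p y) ||
    (padic_abs R p (x' - y) < padic_abs R p (z - y)) -> t <= s ->
  kernel R p x z * (v - s) - kernel R p x' z * (v - t) <=
  shell_weight R p x z * (t - s).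
Proof.
move=> pp xy x'y /(padic_abs_far pp xy)[e zx] /(padic_abs_far pp x'y)[e' _] ts.
apply: (@flow_le _ (kernel R p x z)) => //; first exact: shell_weight_le_kernel.
by rewrite (@kernel_eq _ _ x x') // ?xy ?x'y // e e'.
Qed.

(** * Constancy on spheres and monotonicity in the distance to [y] *)

Lemma sphere_const (R : realType) (p m d : nat) (rho : R)
    (y : Xset p m d) (u : Xset p m d -> R) (r : R) :
  prime p -> (0 < d)%N ->
  0 < rho -> rho <= p%:R ^- d - p%:R ^- (d + m) ->
  (forall x, Dop u x + rho * expR (u x) = rho * p%:R ^+ d * (x == y)%:R) ->
  0 < r ->
  let S := [pred z : Xset p m d |
    (padic_abs R p (val z) == padic_abs R p (val y)) &&
    (padic_abs R p (val z - val y) == r)] in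
  {in S &, forall x x', u x = u x'}.
Proof.
move=> pp d0 rho0 hrho hu r0 S x1 x2 Sx1 Sx2.
case: (@arg_maxP _ _ _ x1 (mem S) u Sx1) => x Sx hx.
have {}hx z : z \in S -> u z <= u x by exact: hx.
case: (@arg_minP _ _ _ x1 (mem S) u Sx1) => x' Sx' hx'.
have {}hx' z : z \in S -> u x' <= u z by exact: hx'.
suff e : u x = u x'.
  have h z : z \in S -> u z = u x.
    by move=> Sz; apply: le_anti; rewrite hx //= e hx'.
  by rewrite !h.
have le : u x' <= u x := hx _ Sx'.
apply/eqP; apply: contraT => ne.
have xx' : x != x' by apply: contraNneq ne => ->.
have lt : u x' < u x by rewrite lt_neqAle le eq_sym ne.
have [/andP[/eqP ax /eqP rx] /andP[/eqP ax' /eqP rx']] := (Sx, Sx').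
have key : Dop u x - Dop u x' <=
    (1 - p%:R ^- m) * (u x' - u x) + p%:R ^- d * \sum_(z : Xset p m d) 0.
  apply: Dop_comparison => // z; rewrite addr0.
  (* Off the sphere, [x] and [x'] are equally distant from [z] and the kernels agree. On it they may
     differ, and the common constant is the shell weight, used with [u x' <= u z <= u x]. *)
  have [Sz|] := boolP (z \in S); last first.
    rewrite inE negb_and; have [ez /=|nz _] := eqVneq; last first.
      by apply: (@flow_le_far _ _ _ _ (val y)); rewrite ?nz.
    rewrite neq_lt => /orP[lr|rl]; last first.
      by apply: (@flow_le_far _ _ _ _ (val y)); rewrite ?rx ?rx' ?rl ?orbT.
    have zx : padic_abs R p (val z - val x) = r.
      by rewrite padic_abs_subC (@padic_abs_center _ _ _ (val y) _ pp) rx.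
    have zx' : padic_abs R p (val z - val x') = r.
      by rewrite padic_abs_subC (@padic_abs_center _ _ _ (val y) _ pp) rx'.
    apply: (@flow_le _ (kernel R p (val x) (val z))) => //.
      apply: shell_weight_le_kernel => //; rewrite -subr_eq0.
      by apply: contraTneq r0; rewrite -zx => ->; rewrite padic_abs0 ltxx.
    by rewrite (@kernel_eq _ _ (val x) (val x')) // ?ax ?ax' ?zx ?zx'.
  have sw : shell_weight R p (val x) (val z) = shell_weight R p (val x') (val z).
    by rewrite /shell_weight ax ax'.
  apply: (@flow_le _ (shell_weight R p (val x) (val z))) => //.
    have [->|zx] := eqVneq z x; first by rewrite subrr !mulr0.
    by rewrite ler_wnM2r ?subr_le0 ?hx // shell_weight_le_kernel.
  have [->|zx'] := eqVneq z x'; first by rewrite subrr !mulr0.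
  by rewrite sw ler_wpM2r ?subr_ge0 ?hx' // shell_weight_le_kernel.
have ny z : z \in S -> (z == y) = false.
  move=> /andP[_ /eqP rz]; apply/negP => /eqP zy; move: r0.
  by rewrite -rz zy subrr padic_abs0 ltxx.
have := hu x; have := hu x'; rewrite !ny // !mulr0.
have [le1 le2] := expR_pair_le pp rho0 hrho hu xx'.
have := expR_sub_le (u x) (u x'); have := expR_gt0 (u x').
move: key; rewrite big1 // mulr0 addr0.
move: le1 le2 lt rho0; set E := expR (u x); set E' := expR (u x').
set P := p%:R ^+ d; set L := 1 - _ => le1 le2 lt rho0 key E'0 sub h' h.
have : rho * (E - E') <= rho * (E * (u x - u x')) by rewrite ler_pM2l.
(* Strict because [E' > 0] forces [E < P]. *)
have : rho * E < L.
  by apply: lt_le_trans le2; rewrite ltr_pM2l //; lra.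
move: key h h' lt; nra.
Qed.

Lemma sphere_mono (R : realType) (p m d : nat) (rho : R)
    (y : Xset p m d) (u : Xset p m d -> R) (x1 x2 : Xset p m d) :
  prime p -> (0 < d)%N ->
  0 < rho -> rho <= p%:R ^- d - p%:R ^- (d + m) ->
  (forall x, Dop u x + rho * expR (u x) = rho * p%:R ^+ d * (x == y)%:R) ->
  padic_abs R p (val x1) = padic_abs R p (val y) ->
  padic_abs R p (val x2) = padic_abs R p (val y) ->
  padic_abs R p (val x1 - val y) < padic_abs R p (val x2 - val y) ->
  u x1 < u x2.
Proof.
move=> pp d0 rho0 hrho hu a1 a2 lt12; set r := padic_abs R p (val x2 - val y).
pose S := [pred z : Xset p m d |
    (padic_abs R p (val z) == padic_abs R p (val y)) &&
    (padic_abs R p (val z - val y) == r)].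
pose B := [pred z : Xset p m d |
    (padic_abs R p (val z) == padic_abs R p (val y)) &&
    (padic_abs R p (val z - val y) < r)].
have Bx1 : x1 \in B by rewrite inE a1 eqxx.
have Sx2 : x2 \in S by rewrite inE a2 !eqxx.
have r0 : 0 < r by apply: le_lt_trans lt12; apply: padic_abs_ge0.
have By : y \in B by rewrite inE eqxx subrr padic_abs0.
(* The maximum is taken at [y] itself whenever [y] attains it, so otherwise [u y < u x] strictly. *)
have [x [Bx hx xy]] : exists x, [/\ x \in B, forall z, z \in B -> u z <= u x &
    x = y \/ u y < u x].
  case: (@arg_maxP _ _ _ x1 (mem B) u Bx1) => x Bx hx.
  have {}hx z : z \in B -> u z <= u x by exact: hx.
  have := hx _ By; rewrite le_eqVlt => /orP[/eqP e|lt]; last first.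
    by exists x; split; auto.
  by exists y; split; auto => z Bz; rewrite e hx.
case: (@arg_minP _ _ _ x2 (mem S) u Sx2) => x' Sx' hx'.
have {}hx' z : z \in S -> u x' <= u z by exact: hx'.
rewrite (le_lt_trans (hx _ Bx1)) // (lt_le_trans _ (hx' _ Sx2)) //.
rewrite ltNge; apply/negP => le.
have [/andP[/eqP ax rx] /andP[/eqP ax' /eqP rx']] := (Bx, Sx').
have nx' : x' == y = false.
  by apply/negP => /eqP e; move: r0; rewrite -rx' e subrr padic_abs0 ltxx.
have xx' : x != x' by apply: contraTneq rx => ->; rewrite rx' ltxx.
(* Exact excess at [z = y] once both kernels are replaced by that of [x']: the flow difference there
   is [g] plus [kernel x' y * (u x' - u x)]. *)
pose g := (kernel R p (val x) (val y) - kernel R p (val x') (val y))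
  * (u y - u x).
have key : Dop u x - Dop u x' <= (1 - p%:R ^- m) * (u x' - u x) +
    p%:R ^- d * \sum_(z : Xset p m d) (if z == y then g else 0).
  apply: Dop_comparison => // z.
  have [ez|nz] := eqVneq (padic_abs R p (val z)) (padic_abs R p (val y));
      last first.
    have zy : z == y = false by apply: contraNF nz => /eqP ->.
    by rewrite zy addr0; apply: (@flow_le_far _ _ _ _ (val y)); rewrite ?nz.
  (* Inside the ball, [z] is closer to [x] than to [x'] and [u z <= u x]; on the sphere, [z] is at
     least as close to [x'] and [u x' <= u z]; beyond it the kernels agree. *)
  have [zr|rz|zr] := ltgtP (padic_abs R p (val z - val y)) r.
  - have zx' : padic_abs R p (val z - val x') = r.
      by rewrite padic_abs_subC (@padic_abs_center _ _ _ (val y) _ pp) rx'.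
    have wle : shell_weight R p (val x) (val z) <= kernel R p (val x') (val z).
      rewrite (_ : shell_weight _ _ _ _ = shell_weight R p (val x') (val z)).
        apply: shell_weight_le_kernel => //; rewrite -subr_eq0.
        by apply: contraTneq r0; rewrite -zx' => ->; rewrite padic_abs0 ltxx.
      by rewrite /shell_weight ax ax'.
    case: eqP => [zy|_].
      have := ler_wnM2r (_ : u x' - u x <= 0) wle; rewrite subr_le0 => /(_ le).
      by rewrite /g zy; lra.
    rewrite addr0; apply: (@flow_le _ (kernel R p (val x') (val z))) => //.
    have [->|zx] := eqVneq z x; first by rewrite subrr !mulr0.
    rewrite ler_wnM2r ?subr_le0 ?hx ?inE ?ez ?eqxx //.
    apply: kernel_le; rewrite ?ax ?ax' //.
    rewrite zx'; apply: le_trans (_ : Num.max (padic_abs R p (val z - val y))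
        (padic_abs R p (val x - val y)) <= _).
      by rewrite (_ : val z - val x = (val z - val y) - (val x - val y))
        ?padic_abs_sub_le //; ring.
    by rewrite ge_max !ltW.
  - have zy : z == y = false.
      by apply/negP => /eqP e; move: rz; rewrite e subrr padic_abs0 lt_gtF.
    rewrite zy addr0; apply: (@flow_le_far _ _ _ _ (val y)) => //.
      by rewrite (lt_trans rx rz) orbT.
    by rewrite rx' rz orbT.
  have zy : z == y = false.
    by apply/negP => /eqP e; move: r0; rewrite -zr e subrr padic_abs0 ltxx.
  have zx : padic_abs R p (val z - val x) = r.
    by rewrite (@padic_abs_center _ _ _ (val y) _ pp) zr.
  have zx0 : val z != val x.
    by rewrite -subr_eq0; apply: contraTneq r0; rewrite -zx => ->;
      rewrite padic_abs0 ltxx.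
  rewrite zy addr0; apply: (@flow_le _ (kernel R p (val x) (val z))) => //.
    exact: shell_weight_le_kernel.
  have [->|zx'] := eqVneq z x'; first by rewrite subrr !mulr0.
  rewrite ler_wpM2r ?subr_ge0 ?hx' ?inE ?ez ?zr ?eqxx //.
  apply: kernel_le; rewrite ?ax ?ax' //.
  rewrite zx (_ : val z - val x' = (val z - val y) - (val x' - val y));
    last by ring.
  by apply: le_trans (padic_abs_sub_le _ _ _ pp) _; rewrite zr rx' maxxx.
have := hu x; have := hu x'; rewrite nx' mulr0.
have [le1 le2] := expR_pair_le pp rho0 hrho hu xx'.
have := expR_sub_le (u x) (u x'); have := expR_gt0 (u x').
move: key; rewrite -big_mkcond big_pred1_eq.
have q0 : 0 < p%:R ^- d :> R by rewrite invr_gt0 exprn_gt0 // ltr0n prime_gt0.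
move: le1 le2 le rho0 q0; set E := expR (u x); set E' := expR (u x').
set L := 1 - _; set q := p%:R ^- d; set P := p%:R ^+ d.
move=> le1 le2 le rho0 q0 key E'0 sub h' h.
have sub' : rho * (E - E') <= rho * (E * (u x - u x')) by rewrite ler_pM2l.
have LE : rho * E < L.
  by apply: lt_le_trans le2; rewrite ltr_pM2l //; lra.
have mul : rho * E * (u x - u x') <= L * (u x - u x').
  by rewrite ler_wpM2r ?subr_ge0 ?(ltW LE).
(* If [x = y] then [g = 0], and the contradiction comes from the source term [rho * P > 0].
   Otherwise neither point is the source, and [g < 0] because [x] is closer to [y] than [x'] is. *)
case: xy => [e|lty].
  have rP : rho * E < rho * P by rewrite ltr_pM2l //; lra.
  have rE : 0 < rho * E by rewrite mulr_gt0 ?expR_gt0.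
  move: h key; rewrite /g e eqxx mulr1 subrr !mulr0 addr0 -e; lra.
have xy : val y != val x.
  by apply: contraTneq lty => /val_inj ->; rewrite ltxx.
have qg : q * g < 0.
  rewrite pmulr_rlt0 // /g pmulr_rlt0 ?subr_lt0 // subr_gt0.
  apply: kernel_lt; rewrite ?Xset_neq0 ?ax ?ax' //.
  by rewrite padic_abs_subC [ltRHS]padic_abs_subC rx'.
have nx : x == y = false.
  by rewrite eq_sym; apply/negP => /eqP e; rewrite e eqxx in xy.
move: h; rewrite nx mulr0; lra.
Qed.

(** * Nonempty spheres and the translation to relative distances *)

(** The flag [b] permits the digit 0. The choice is 1 unless [c = 1], then 0 if permitted and 2
    otherwise. *)
Lemma other_digit (p : nat) (c : 'I_p) (b : bool) : (1 < p)%N ->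
  b || (2 < p)%N -> exists2 a : 'I_p, a != c & b || (a != 0%N :> nat).
Proof.
move=> p1 hb.
have h (a : 'I_p) : a != c -> b || (a != 0%N :> nat) -> exists2 a : 'I_p,
    a != c & b || (a != 0%N :> nat) by exists a.
have [c1|c1] := eqVneq (c : nat) 1%N; last first.
  by apply: (h (Ordinal p1)); rewrite ?orbT // -val_eqE /= eq_sym.
case: b h hb => /= h hb.
  by apply: (h (Ordinal (ltnW p1))); rewrite // -val_eqE /= c1.
by apply: (h (Ordinal hb)); rewrite // -val_eqE /= c1.
Qed.

Lemma padic_abs_pnat (R : realType) (p n k : nat) : prime p ->
  ~~ (p %| n)%N -> padic_abs R p (p ^ k * n)%:R = p%:R ^- k.
Proof.
move=> pp pn; rewrite /padic_abs padic_val_pnat // -exprnN.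
rewrite pnatr_eq0 muln_eq0 expn_eq0 eqn0Ngt prime_gt0 //=.
by case: eqP pn => // ->; rewrite dvdn0.
Qed.

(** Changing only digit [k] of [y] moves it by [p^(l+k)] times a nonzero difference of digits, which
    is prime to [p]. At [k = 0] the new digit must be nonzero, whence [p > 2]. *)
Lemma shell_sphere_nonempty (R : realType) (p m d : nat) (y : Xset p m d)
    (k : nat) : prime p -> (k < d)%N -> (0 < k)%N || (2 < p)%N ->
  exists x, x \in shell_sphere R y k.
Proof.
move=> pp kd hk; have d0 : (0 < d)%N by apply: leq_ltn_trans kd.
have [l [b bd yE]] := XsetP y; pose k' := Ordinal kd.
have [a ab ha] := other_digit (b k') (prime_gt1 pp) hk.
pose b' := [ffun i => if i == k' then a else b i].
have b'd : b' \in @digits p d.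
  apply/forallP => i; rewrite ffunE; case: (i =P k') => [->|_].
    by move: ha; rewrite lt0n /=; case: (k == 0%N).
  by have /forallP /(_ i) := bd.
exists [` padic_point_Xset l b'd]%fset; rewrite inE /=.
have v : padic_val p (padic_point l b') = padic_val p (val y).
  by rewrite yE !padic_val_point.
rewrite v eqxx /= padic_rdist_shell ?padic_point_neq0 ?Xset_neq0 //.
rewrite yE padic_abs_point // exprVn.
suff -> : padic_abs R p (padic_point l b' - padic_point l b) = p%:R ^- (l + k).
  by rewrite exprD invfM mulrAC divff ?mul1r // invr_eq0 expf_neq0 // pnatr_eq0
    -lt0n prime_gt0.
have -> : padic_point l b' - padic_point l b =
    p%:R ^+ (l + k) * ((a : nat)%:R - (b k' : nat)%:R).
  rewrite /padic_point -mulrBr -sumrB (bigD1 k') //= big1 => [|i ik]; last first.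
    by rewrite ffunE (negPf ik) subrr.
  by rewrite ffunE eqxx exprD; ring.
have ndvd (i j : 'I_p) : (i < j)%N -> ~~ (p %| j - i)%N.
  move=> ij; apply/negP => /dvdn_leq; rewrite subn_gt0 => /(_ ij).
  by have := ltn_ord j; lia.
have [lt|lt|/val_inj e] := ltngtP (a : nat) (b k').
- by rewrite -padic_absN -mulrN opprB -natrB 1?ltnW // -natrX -natrM
    padic_abs_pnat ?ndvd.
- by rewrite -natrB 1?ltnW // -natrX -natrM padic_abs_pnat ?ndvd.
by rewrite e eqxx in ab.
Qed.

Lemma shell_sphereE (R : realType) (p m d : nat) (x y : Xset p m d) (k : nat) :
  prime p -> (0 < d)%N -> (x \in shell_sphere R y k) =
  (padic_abs R p (val x) == padic_abs R p (val y)) &&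
  (padic_abs R p (val x - val y) == p%:R ^- k * padic_abs R p (val y)).
Proof.
move=> pp d0; have y0 := Xset_neq0 y pp d0; have x0 := Xset_neq0 x pp d0.
rewrite inE -padic_abs_eq_val //; case: eqP => //= v.
have ay : padic_abs R p (val y) != 0 by rewrite gt_eqF ?padic_abs_gt0.
by rewrite padic_rdist_shell //; apply/eqP/eqP => [<-|->]; rewrite ?divfK ?mulfK.
Qed.

Unset Implicit Arguments.

Theorem theorem3p7 (R : realType) (p m d : nat) (rho : R)
    (hp : prime p) (hm : (1 <= m)%N) (hd : (1 <= d)%N)
    (hrho0 : 0 < rho) (hrho : rho <= p%:R ^- d - p%:R ^- (d + m))
    (y : Xset p m d) (u : Xset p m d -> R)
    (hu : forall x : Xset p m d,
      Dop u x + rho * expR (u x) = rho * p%:R ^+ d * (x == y)%:R) :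
  (forall x x' : Xset p m d,
     padic_val p (val x) = padic_val p (val y) ->
     padic_val p (val x') = padic_val p (val y) ->
     padic_rdist R p (val x) (val y) < padic_rdist R p (val x') (val y) ->
     u x < u x')
  /\
  (* For [y = p^l (c_0 + ... + c_(d-1) p^(d-1))], [U k] is
     u_l(c_0, ..., c_(k-1)) and [U 0] is u_l; for [p = 2] no point of
     the shell is at distance 1 from [y], so u_l does not exist. *)
  (exists U : nat -> R,
     [/\ U d = u y,
         forall k : nat, (k < d)%N -> (0 < k)%N || (2 < p)%N ->
           common_value u (shell_sphere R y k) (U k)
       & forall k : nat, (k < d)%N -> (0 < k)%N || (2 < p)%N ->
           U k.+1 < U k]).
Proof.
have ay : 0 < padic_abs R p (val y) by rewrite padic_abs_gt0 ?Xset_neq0.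
have mono x x' : padic_val p (val x) = padic_val p (val y) ->
    padic_val p (val x') = padic_val p (val y) ->
    padic_rdist R p (val x) (val y) < padic_rdist R p (val x') (val y) ->
    u x < u x'.
  move=> vx vx'; rewrite !padic_rdist_shell ?Xset_neq0 // ltr_pM2r ?invr_gt0 //.
  by apply: (sphere_mono hp hd hrho0 hrho hu); apply/eqP;
    rewrite -padic_abs_eq_val ?Xset_neq0 // ?vx ?vx'.
split=> //.
(* The value 0 arises only for an empty sphere, that is for [k = 0] and [p = 2]; indices [k >= d]
   give [u y]. *)
pose U k := if (k < d)%N then
  (if [pick x in shell_sphere R y k] is Some x then u x else 0) else u y.
have UP k : (k < d)%N -> (0 < k)%N || (2 < p)%N ->
    exists2 x, x \in shell_sphere R y k & U k = u x.
  move=> kd hk; rewrite /U kd; case: pickP => [x xk|none]; first by exists x.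
  by have [x] := shell_sphere_nonempty R y hp kd hk; rewrite none.
exists U; split=> [|k kd hk|k kd hk]; first by rewrite /U ltnn.
  have [x xk ->] := UP k kd hk; split=> [|z zk]; first by exists x.
  apply: (sphere_const hp hd hrho0 hrho hu
    (r := p%:R ^- k * padic_abs R p (val y))).
  - by rewrite mulr_gt0 ?invr_gt0 ?exprn_gt0 // ltr0n prime_gt0.
  - by rewrite inE -shell_sphereE.
  - by rewrite inE -shell_sphereE.
have [x' + ->] := UP k kd hk; rewrite inE => /andP[/eqP vx' /eqP dx'].
have p0 i : 0 < p%:R ^- i :> R by rewrite invr_gt0 exprn_gt0 // ltr0n prime_gt0.
(* When [k.+1 = d], the inner sphere is replaced by the single point [y], at distance 0. *)
have [k1d|dk] := ltnP k.+1 d; last first.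
  rewrite /U ltnNge dk /=; apply: mono => //.
  by rewrite dx' /padic_rdist subrr padic_abs0 mul0r.
have [x + ->] := UP k.+1 k1d isT; rewrite inE => /andP[/eqP vx /eqP dx].
apply: mono => //; rewrite dx dx' ltf_pV2 ?posrE ?exprn_gt0 ?ltr0n ?prime_gt0 //.
by rewrite ltr_eXn2l // ltr1n prime_gt1.
Qed.
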